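(* Let $p$ be an odd prime and let $\mathbb{F}_q$ be a finite field with $q$ elements and characteristic $p$, with prime field $\mathbb{F}_p$. Set $$\nu_p=\max_{\gamma\in\mathbb{F}_p\setminus\{1\}}\left|\{1\leq i\leq p-2:\ \gamma^{i+1}=i(1-\gamma)+1\}\right|,$$ where $i$ ranges over integers and the equation is in $\mathbb{F}_p$. If $f\in\mathbb{F}_q[x]$ is a permutation polynomial of $\mathbb{F}_q$ with $Crk(f)=2$, then $$\omega(f)\geq q-\frac{q}{p}-1-\nu_p.$$ Furthermore, $0\leq\nu_p\leq\sqrt{\frac{3p}{2}-\frac{39}{16}}+\frac54$.
   Context: A polynomial $f\in\mathbb{F}_q[x]$ is a permutation polynomial of $\mathbb{F}_q$ if the map $a\mapsto f(a)$ is a permutation of $\mathbb{F}_q$. The weight $\omega(f)$ is the number of non-zero coefficients of $f$. Every permutation polynomial $f$ of $\mathbb{F}_q$ is congruent modulo $x^q-x$ to a polynomial of the form $\mathcal{P}_n(x)=(\dots((a_0x+a_1)^{q-2}+a_2)^{q-2}\dots+a_n)^{q-2}+a_{n+1}$ for some $n\ge 0$, where $a_1,a_{n+1}\in\mathbb{F}_q$ and $a_0,a_2,\dots,a_n\in\mathbb{F}_q^*$ (for $n=0$: $\mathcal{P}_0(x)=a_0x+a_1$ with $a_0\ne0$; for $n=1$: $\mathcal{P}_1(x)=(a_0x+a_1)^{q-2}+a_2$ with $a_0\neq 0$; for $n=2$: $\mathcal{P}_2(x)=((a_0x+a_1)^{q-2}+a_2)^{q-2}+a_3$ with $a_0,a_2\ne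 0$). The Carlitz rank $Crk(f)$ is the smallest integer $n$ for which there is such a $\mathcal{P}_n$ with $f(x)\equiv\mathcal{P}_n(x)\pmod{x^q-x}$. *)

(* Defs.v *)
From mathcomp Require Import all_boot all_order all_algebra.

Set Implicit Arguments.
Unset Strict Implicit.
Unset Printing Implicit Defensive.

Import Order.TTheory GRing.Theory Num.Theory.

Local Open Scope ring_scope.

Definition perm_poly (F : finFieldType) (f : {poly F}) : Prop :=
  bijective (fun a : F => f.[a]).

Definition weight (F : finFieldType) (f : {poly F}) : nat :=
  count (fun c => c != 0) f.

(* Only a 0, ..., a n.+1 occur in carlitz_poly a n. *)
Fixpoint carlitz_poly (F : finFieldType) (a : nat -> F) (n : nat) : {poly F} :=
  match n with
  | 0%N => a 0%N *: 'X + (a 1%N)%:P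
  | m.+1 => carlitz_poly a m ^+ (#|F| - 2) + (a m.+2)%:P
  end.

Definition carlitz_form (F : finFieldType) (f : {poly F}) (n : nat) : Prop :=
  exists a : nat -> F,
    [/\ a 0%N != 0,
        forall i : nat, (2 <= i <= n)%N -> a i != 0 &
        f %% ('X^#|F| - 'X) = carlitz_poly a n %% ('X^#|F| - 'X)].

(* A relation rather than a function: that every permutation polynomial has
   some carlitz_form is a theorem of Carlitz. *)
Definition carlitz_rank (F : finFieldType) (f : {poly F}) (n : nat) : Prop :=
  carlitz_form f n /\ forall m : nat, carlitz_form f m -> (n <= m)%N.

(* 'F_p has p elements only for prime p. *)
Definition nu (p : nat) : nat :=
  \max_(g : 'F_p | g != 1%R)
    #|[set i : 'I_p | (1 <= i <= p - 2)%N &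
                      (g ^+ i.+1 == i%:R * (1 - g) + 1)%R]|.

(* Main.v *)
(* With b and c the zeros of the denominator and of the numerator of the Moebius
   transformation underlying f, interpolation gives, for 0 < j < q - 1, the
   coefficient of x^j in f up to a factor as
     (c - b) (j + 1) b^(q-2-j) - c^(q-1-j) + b^(q-1-j).
   When b c != 0 it vanishes iff d^(j+1) = j (1 - d) + 1, where d = b / c != 1;
   it vanishes only for j divisible by p if c = 0, and never if b = 0.

   If d lies in F_p, the equation is periodic in j with period p (p - 1), has at
   most one solution per class of j modulo p - 1, and q / p = 1 mod p - 1, so
   only one incomplete block of length p is left, which nu_p controls.  If d is
   not in F_p, of order e, the points of the line 1 + F_p (1 - d) in <d> have
   distinct ratios, so there are m of them with m (m - 1) < e, and the solutions
   number at most m (q / (p e) + 1).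

   For the bound on nu_p: subtracting the equations at i and i + d shows that d
   determines i, so the solutions have pairwise distinct differences. *)
Require Import Defs.
From mathcomp Require Import all_boot all_order all_algebra all_field.
From mathcomp Require Import zify ring lra.

Set Implicit Arguments.
Unset Strict Implicit.
Unset Printing Implicit Defensive.

Import Order.TTheory GRing.Theory Num.Theory.

Local Open Scope ring_scope.

(** * Sums and distinct differences of natural numbers *)

(** The i-th term is at least x + i; doubling clears the halves. *)
Lemma size_path_ltn_sumn (x : nat) (s : seq nat) :
  path ltn x s -> (size s * x.*2 + size s * (size s).+1 <= (sumn s).*2)%N.
Proof.
elim: s x => [|y s IHs] x //= /andP[ltxy /IHs IH].
suff : (size s * x.*2 + size s * 2 <= size s * y.*2)%N by lia.
by rewrite -mulnDr leq_mul2l; apply/orP; right; lia.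
Qed.

Lemma size_uniq_pos_sumn (s : seq nat) :
  uniq s -> 0%N \notin s -> (size s * (size s).+1 <= (sumn s).*2)%N.
Proof.
move=> s_uniq s_pos; have sortP := permEl (perm_sort leq s).
rewrite -(perm_size sortP) -(perm_sumn sortP).
have := @size_path_ltn_sumn 0 (sort leq s); rewrite muln0 add0n; apply.
rewrite path_min_sorted.
  by rewrite ltn_sorted_uniq_leq sort_uniq s_uniq sort_sorted //; exact: leq_total.
apply/allP => i; rewrite mem_sort; case: i => //.
by rewrite (negPf s_pos).
Qed.

(* The differences of terms at distance one or two in [s] are distinct, while
   their sum telescopes to at most [3 M]. *)
Lemma size_distinct_differences (a M : nat) (s : seq nat) :
    sorted ltn s -> {in s, forall i, a <= i <= a + M}%N ->
    (forall i j d, 0 < d -> i \in s -> i + d \in s -> j \in s -> j + d \in s ->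
       i = j)%N ->
  (((size s).-1 + (size s).-2) * ((size s).-1 + (size s).-2).+1 <= 6 * M)%N.
Proof.
move=> s_sorted s_range s_diff; set n := size s; set f := nth 0%N s.
have f_in i : (i < n)%N -> f i \in s by exact: mem_nth.
have f_lt i j : (i < j < n)%N -> (f i < f j)%N.
  move=> /andP[ij jn]; apply: (sorted_ltn_nth ltn_trans) => //.
  by rewrite inE (ltn_trans ij jn).
have f_diff i j k l : (i < j < n)%N -> (k < l < n)%N ->
    (f j - f i = f l - f k)%N -> i = k /\ j = l.
  move=> ijn kln e; have lt1 := f_lt _ _ ijn; have lt2 := f_lt _ _ kln.
  have fik : f i = f k.
    apply: (s_diff _ _ (f j - f i)%N); try apply: f_in; try lia.
    - by rewrite subnKC; [apply: f_in; lia|lia].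
    - by rewrite e subnKC; [apply: f_in; lia|lia].
  have fjl : f j = f l by lia.
  have f_inj u v : (u < n)%N -> (v < n)%N -> f u = f v -> u = v.
    move=> un vn /eqP; rewrite nth_uniq //; first by move/eqP.
    by apply: sorted_uniq s_sorted; [exact: ltn_trans|exact: ltnn].
  by split; apply: f_inj => //; lia.
pose D k := [seq (f (i + k) - f i)%N | i <- index_iota 0 (n - k)].
have D_uniq k : (0 < k)%N -> uniq (D k).
  move=> k0; rewrite map_inj_in_uniq ?iota_uniq // => i j.
  rewrite !mem_index_iota => ? ? e.
  by have [] := f_diff i (i + k)%N j (j + k)%N _ _ e; lia.
have D_pos k : (0 < k)%N -> 0%N \notin D k.
  move=> k0; apply/mapP => -[i]; rewrite mem_index_iota => ? e.
  by have := f_lt i (i + k)%N; lia.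
(* A common value would match (i, i + 2) with (j, j + 1), forcing i = j and i + 2 = j + 1. *)
have U : uniq (D 1%N ++ D 2%N).
  rewrite cat_uniq !D_uniq // andbT; apply/hasPn => d /mapP[i].
  rewrite mem_index_iota => ? ->; apply/negP => /mapP[j].
  rewrite mem_index_iota => ? e.
  by have [] := f_diff i (i + 2)%N j (j + 1)%N _ _ e; lia.
have Z : 0%N \notin D 1%N ++ D 2%N by rewrite mem_cat negb_or !D_pos.
have := size_uniq_pos_sumn U Z.
rewrite size_cat !size_map !size_iota !subn0 subn1 subn2.
have f_range i : (i < n)%N -> (a <= f i <= a + M)%N by move/f_in/s_range.
have tele k b : (b + k < n)%N ->
    (\sum_(0 <= i < k) (f (b + i).+1 - f (b + i)) <= M)%N.
  move=> bk; rewrite (eq_bigr (fun i => f (b + i.+1) - f (b + i)))%N; last first.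
    by move=> i _; rewrite addnS.
  rewrite (@telescope_sumn_in 0 k (fun i => f (b + i)%N)) // => [|i ik].
    by have := f_range (b + 0)%N; have := f_range (b + k)%N; lia.
  by apply/ltnW/f_lt; lia.
have D1 : (sumn (D 1%N) <= M)%N.
  rewrite sumnE big_map.
  case: (posnP n) => [->|n0]; first by rewrite big_geq.
  by under eq_bigr do rewrite addn1; apply: (tele _ 0%N); lia.
have D2 : (sumn (D 2%N) <= 2 * M)%N.
  have [n1|n1] := leqP n 1; first by rewrite /D (_ : n - 2 = 0)%N //; lia.
  rewrite sumnE big_map.
  (* A difference at distance two is the sum of two consecutive ones, so two telescoping sums
     arise. *)
  rewrite big_nat (eq_bigr (fun i =>
    (f (1 + i).+1 - f (1 + i)) + (f (0 + i).+1 - f (0 + i))))%N; last first.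
    move=> i ik; rewrite addn2 add1n add0n.
    by have := f_lt i i.+1; have := f_lt i.+1 i.+2; lia.
  rewrite -big_nat big_split /=.
  by have := tele (n - 2)%N 1%N; have := tele (n - 2)%N 0%N; lia.
by rewrite sumn_cat; lia.
Qed.

(** * The equation g^(i+1) = i (1 - g) + 1 *)

Lemma eqr_nat_pchar (R : nzRingType) (p : nat) (charR : p \in [pchar R])
    (m n : nat) :
  (m%:R == n%:R :> R) = (m == n %[mod p]).
Proof.
wlog le_nm : m n / (n <= m)%N => [IH|].
  by have [/IH //|/ltnW/IH] := leqP n m; rewrite eq_sym => ->; exact: eq_sym.
by rewrite eqn_mod_dvd // (dvdn_pcharf charR) natrB // subr_eq0.
Qed.

Lemma card_ord_count (n : nat) (P : pred nat) :
  #|[set i : 'I_n | P i]| = count P (iota 0 n).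
Proof.
rewrite -sum1_card (eq_bigl (fun i : 'I_n => P i)); last by move=> i; rewrite inE.
by rewrite -(big_mkord P (fun=> 1%N)) sum1_count /index_iota subn0.
Qed.

(** Stated over a general ring, so as to serve both in ['F_p], as in [nu], and in its extensions. *)
Definition carlitz_eq (R : nzRingType) (g : R) (i : nat) : bool :=
  g ^+ i.+1 == i%:R * (1 - g) + 1.

Lemma carlitz_eq_rmorph (K : fieldType) (L : nzRingType)
    (phi : {rmorphism K -> L}) (g : K) (i : nat) :
  carlitz_eq (phi g) i = carlitz_eq g i.
Proof.
rewrite /carlitz_eq -(inj_eq (fmorph_inj phi)).
by rewrite rmorphXn rmorphD rmorphM rmorphB rmorph_nat rmorph1.
Qed.

Lemma carlitz_eq0 (R : nzRingType) (g : R) : g != 1 -> ~~ carlitz_eq g 0.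
Proof. by rewrite /carlitz_eq expr1 mul0r add0r. Qed.

(** For p | n the index n - 1 acts as -1, so the right side is g. At n = q this gives a solution
    just past the range 1, ..., q - 2; discarding it makes the later bounds strict. *)
Lemma carlitz_eq_pred (R : comNzRingType) (p : nat) (charR : p \in [pchar R])
    (g : R) (n : nat) :
  (0 < n)%N -> (p %| n)%N -> g ^+ n = g -> carlitz_eq g n.-1.
Proof.
case: n => // n _; rewrite /carlitz_eq (dvdn_pcharf charR) -natr1 addr_eq0.
by move=> /eqP-> ->; apply/eqP; ring.
Qed.

Lemma count_iota_inner (P : pred nat) (n : nat) :
  (1 < n)%N -> P n.-1 -> (count P (iota 1 (n - 2)) < count P (iota 0 n))%N.
Proof.
move=> n1 Pn; rewrite [X in iota 0 X](_ : n = 1 + (n - 2) + 1)%N; last by lia.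
rewrite !iotaD !count_cat /= add0n (_ : 1 + (n - 2) = n.-1)%N; last by lia.
by rewrite Pn; lia.
Qed.

Lemma carlitz_eq_mod (K : fieldType) (p : nat) (charK : p \in [pchar K])
    (g : K) (i j : nat) :
  g != 1 -> carlitz_eq g i -> carlitz_eq g j -> g ^+ i.+1 = g ^+ j.+1 ->
  i = j %[mod p].
Proof.
move=> g1 /eqP-> /eqP-> /addIr /mulIf e; apply/eqP.
by rewrite -(eqr_nat_pchar charK); apply/eqP/e; rewrite subr_eq0 eq_sym.
Qed.

(** Subtraction gives (g^d - 1) g^(k+1) = d (1 - g) for k = i and k = j. The right side is nonzero
    as 0 < d < p, so g^d - 1 cancels. *)
Lemma carlitz_eq_diff (K : fieldType) (p : nat) (charK : p \in [pchar K])
    (g : K) (i j d : nat) :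
  g != 1 -> (0 < d < p)%N -> carlitz_eq g i -> carlitz_eq g (i + d) ->
  carlitz_eq g j -> carlitz_eq g (j + d) -> i = j %[mod p].
Proof.
move=> g1 dp gi gid gj gjd; apply: (carlitz_eq_mod charK g1 gi gj).
have step k : carlitz_eq g k -> carlitz_eq g (k + d) ->
    (g ^+ d - 1) * g ^+ k.+1 = d%:R * (1 - g).
  move=> /eqP gk /eqP; rewrite -addSn exprD natrD mulrDl addrAC -gk => gkd.
  by rewrite mulrBl mul1r [X in X - _]mulrC gkd addrAC subrr add0r.
have := step _ gj gjd; rewrite -(step _ gi gid) => /mulfI -> //.
apply/eqP => gd; have /esym/eqP := step _ gi gid.
rewrite gd mul0r mulf_eq0 subr_eq0 [1 == g]eq_sym (negPf g1) orbF.
by rewrite -(dvdn_pcharf charK) gtnNdvd //; lia.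
Qed.

Lemma eq_mod_block (e p i j : nat) :
  coprime e p -> i = j %[mod e] -> i = j %[mod p] ->
  (i %/ p %/ e = j %/ p %/ e)%N -> i = j.
Proof.
rewrite -!divnMA coprime_sym => co /eqP ije /eqP ijp q.
have /eqP r : (i == j %[mod p * e])%N by rewrite chinese_remainder // ijp.
by rewrite (divn_eq i (p * e)) (divn_eq j (p * e)) q r.
Qed.

(** The pairs (f i, h i) are distinct. In use, h i is the block containing i. *)
Lemma size_le_mul (I T U : eqType) (f : I -> T) (h : I -> U)
    (s : seq I) (A : seq T) (B : seq U) :
  uniq s -> {in s, forall i, f i \in A} -> {in s, forall i, h i \in B} ->
  {in s &, forall i j, f i = f j -> h i = h j -> i = j} ->
  (size s <= size A * size B)%N.
Proof.
move=> s_uniq fA hB fh_inj; rewrite -(size_allpairs pair).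
rewrite -(size_map (fun i => (f i, h i)) s); apply: uniq_leq_size.
  by rewrite map_inj_in_uniq // => i j si sj [fij hij]; apply: fh_inj.
by move=> _ /mapP[i si ->]; apply: allpairs_f; [apply: fA | apply: hB].
Qed.

Lemma count_iota_nu (p : nat) (g : 'F_p) : (1 < p)%N ->
  g != 1 -> (count (carlitz_eq g) (iota 1 (p - 2)) <= nu p)%N.
Proof.
move=> p1 g1; rewrite /nu; apply: leq_trans (leq_bigmax_cond g g1).
pose P i := (1 <= i <= p - 2)%N && carlitz_eq g i.
rewrite (card_ord_count p P).
rewrite [X in iota 0 X](_ : p = 1 + (p - 2) + 1)%N; last by lia.
rewrite !iotaD !count_cat add0n.
apply: leq_trans (leq_addr _ _); apply: leq_trans (leq_addl _ _).
apply/eq_leq/eq_in_count => i; rewrite mem_iota => ip; rewrite /P.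
by rewrite (_ : 1 <= i <= p - 2)%N //; lia.
Qed.

(** * The upper bound for [nu] *)

(** With the root cleared, the claim is (nu p - 5/4)^2 <= 3p/2 - 39/16. *)
Lemma nu_quadratic_bound (p : nat) : prime p -> odd p ->
  (2 * nu p ^ 2 + 8 <= 3 * p + 5 * nu p)%N.
Proof.
move=> p_prime p_odd; have p_gt2 := odd_prime_gt2 p_odd p_prime.
rewrite /nu; elim/big_rec: _ => [|g n g1 IHn]; first by lia.
rewrite /maxn; case: ltnP => // _.
pose P i := (1 <= i <= p - 2)%N && carlitz_eq g i.
rewrite (card_ord_count p P) -size_filter; set s := filter _ _.
have s_in i : i \in s -> (1 <= i <= p - 2)%N /\ carlitz_eq g i.
  by rewrite mem_filter => /andP[/andP[]].
have s_lt i : i \in s -> (i < p)%N by case/s_in; lia.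
suff : (((size s).-1 + (size s).-2) * ((size s).-1 + (size s).-2).+1
          <= 6 * (p - 3))%N.
  by case: (size s) => [|[|k]] /=; [lia|lia|nia].
(* The solutions lie in 1, ..., p - 2, an interval of length p - 3. *)
apply: (@size_distinct_differences 1).
- by apply: sorted_filter; [exact: ltn_trans|exact: iota_ltn_sorted].
- by move=> i /s_in[]; lia.
move=> i j d d0 si sid sj sjd.
rewrite -(modn_small (s_lt _ si)) -(modn_small (s_lt _ sj)).
have dp : (0 < d < p)%N by have := s_lt _ sid; lia.
by apply: (carlitz_eq_diff (pchar_Fp p_prime) g1 dp); apply s_in.
Qed.

(** * Counting the solutions in the range 1, ..., q - 2 *)

(** [Q] stands for q / p. The first p (Q - 1) indices hold at most Q - 1 solutions, the last p at
    most nu p + 1; among the latter is q - 1, which is out of range. *)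
Lemma count_carlitz_eq_Fp (p : nat) (g : 'F_p) (Q : nat) :
  prime p -> g != 0 -> g != 1 -> (0 < Q)%N -> (p.-1 %| Q.-1)%N ->
  (count (carlitz_eq g) (iota 1 (p * Q - 2)) < Q + nu p)%N.
Proof.
move=> p_prime g0 g1 Q_gt0 dvdQ; have p_gt1 := prime_gt1 p_prime.
have charFp := pchar_Fp p_prime.
have gX1 : g ^+ p.-1 = 1.
  apply: (mulfI g0); rewrite -exprS prednK ?mulr1; last by lia.
  by have := expf_card g; rewrite card_Fp.
have gX n : (p.-1 %| n)%N -> g ^+ n = 1.
  by move=> /dvdnP[k ->]; rewrite mulnC exprM gX1 expr1n.
have last_root : carlitz_eq g (p * Q).-1.
  apply: (carlitz_eq_pred charFp); rewrite ?muln_gt0 ?dvdn_mulr //; first by lia.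
  have -> : (p * Q = p + p * Q.-1)%N by nia.
  rewrite exprD [g ^+ (_ * _)]gX ?dvdn_mull // mulr1.
  by rewrite -[X in g ^+ X](card_Fp p_prime) expf_card.
(* A shift by a multiple of both p and p - 1 changes neither side. *)
have periodic i : carlitz_eq g (p * Q.-1 + i) = carlitz_eq g i.
  rewrite /carlitz_eq -addnS exprD gX ?dvdn_mull // mul1r natrD natrM.
  by rewrite (pcharf0 charFp) mul0r add0r.
have total : (count (carlitz_eq g) (iota 0 (p * Q)) <= Q + nu p)%N.
  rewrite [X in iota 0 X](_ : _ = p * Q.-1 + p)%N; last by nia.
  rewrite iotaD count_cat add0n -[X in iota X p]addn0 iotaDl count_map.
  rewrite (eq_count (a2 := carlitz_eq g)) //.
  have blocks : (count (carlitz_eq g) (iota 0 (p * Q.-1)) <= Q.-1)%N.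
    rewrite -size_filter; set s := filter _ _.
    have [k Qk] := dvdnP dvdQ; rewrite Qk mulnC.
    rewrite -[X in (X * _)%N](size_iota 0) -[X in (_ * X)%N](size_iota 0).
    have s_in i : i \in s -> (i < p * Q.-1)%N /\ carlitz_eq g i.
      by rewrite mem_filter mem_iota => /andP[].
    apply: (@size_le_mul _ _ _ (modn^~ p.-1) (fun i => i %/ p %/ p.-1)%N).
    - by rewrite filter_uniq ?iota_uniq.
    - by move=> i _; rewrite mem_iota /= ltn_mod -subn1 subn_gt0.
    - move=> i /s_in[lt_i _]; rewrite mem_iota /= -divnMA ltn_divLR; last by nia.
      by move: lt_i; rewrite Qk; nia.
    move=> i j /s_in[_ gi] /s_in[_ gj] ij_e; apply: eq_mod_block => //.
      by rewrite coprime_sym; case: (p) p_gt1 => // m _; exact: coprimeSn.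
    apply: (carlitz_eq_mod charFp g1 gi gj); rewrite !exprS; congr (_ * _).
    by rewrite -(expr_mod i gX1) -(expr_mod j gX1) ij_e.
  (* Among 0, ..., p - 1, the index 0 is no solution, and p - 1 adds at most one to the count in
     [nu]. *)
  suff : (count (carlitz_eq g) (iota 0 p) <= nu p + 1)%N by lia.
  rewrite [X in iota 0 X](_ : p = 1 + (p - 2) + 1)%N; last by lia.
  rewrite !iotaD !count_cat /= (negPf (carlitz_eq0 g1)) !add0n addn0.
  by apply: leq_add; [exact: count_iota_nu | exact: leq_b1].
by apply: leq_trans (count_iota_inner _ last_root) total; nia.
Qed.

(* Two distinct points of the line [1 + k (1 - d)] are determined by their
   ratio, as [1] and [d] are linearly independent over [k]. *)
Lemma card_line_unity_roots (k L : finFieldType) (phi : {rmorphism k -> L})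
    (d : L) (e : nat) :
  d \notin codom phi -> (0 < e)%N ->
  let A := [set x : L | (x ^+ e == 1) &&
                        [exists a, x == phi a * (1 - d) + 1]] in
  (#|A| * #|A|.-1 < e)%N.
Proof.
move=> d_out e_gt0; set A := [set x | _] => /=.
have indep (a b : k) : phi a * (1 - d) + phi b = 0 -> a = 0 /\ b = 0.
  have [-> | a0] := eqVneq a 0.
    rewrite rmorph0 mul0r add0r => /eqP; rewrite fmorph_eq0 => /eqP->.
    by split.
  move=> E; case/negP: d_out; apply/codomP; exists (1 + b / a).
  have pa0 : phi a != 0 by rewrite fmorph_eq0.
  rewrite rmorphD fmorph_div rmorph1; apply: (mulfI pa0).
  rewrite mulrDr mulrCA mulfV // mulr1; move/eqP: E; rewrite addr_eq0.
  move=> /eqP E; have -> : phi b = - (phi a * (1 - d)) by rewrite E opprK.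
  by ring.
have d1 : 1 - d != 0.
  apply: contra d_out; rewrite subr_eq0 => /eqP<-.
  by apply/codomP; exists 1; rewrite rmorph1.
pose D := setX A A :\: [set u | u.1 == u.2].
have card_D : (#|A| * #|A| <= #|A| + #|D|)%N.
  rewrite -cardsX -(cardsID [set u | u.1 == u.2] (setX A A)) leq_add2r.
  apply: leq_trans (leq_imset_card (fun x => (x, x)) _).
  apply/subset_leq_card/subsetP => -[x y]; rewrite !inE /=.
  by move=> /andP[/andP[Ax _] /eqP <-]; apply: imset_f; rewrite inE.
have A_neq0 x : x \in A -> x != 0.
  rewrite inE => /andP[xe _]; apply: contraTneq xe => ->.
  by rewrite expr0n eqn0Ngt e_gt0 eq_sym oner_eq0.
have ratio_inj : {in D &, injective (fun u => u.1 / u.2)}.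
  move=> [x y] [x' y'] /setDP[/setXP[/= Ax Ay]]; rewrite inE /= => xy.
  move=> /setDP[/setXP[/= Ax' Ay'] _] /eqP.
  rewrite eqr_div ?A_neq0 // => /eqP.
  move: Ax Ay Ax' Ay' xy; rewrite !inE.
  move=> /andP[_ /existsP[a /eqP->]] /andP[_ /existsP[b /eqP->]].
  move=> /andP[_ /existsP[a' /eqP->]] /andP[_ /existsP[b' /eqP->]] xy E.
  have ab : a != b by apply: contraNneq xy => ->.
  have [| E1 E2] := indep (a * b' - a' * b) (a + b' - (a' + b)).
    apply: (mulIf d1); rewrite mul0r !rmorphB !rmorphD !rmorphM /=.
    by move/eqP: E; rewrite -subr_eq0 => /eqP <-; ring.
  (* Substituting b' = a' + b - a into a b' = a' b gives this factorization. *)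
  have /eqP : (a - b) * (a' - a) = 0.
    have -> : (a - b) * (a' - a) = a * b' - a' * b - a * (a + b' - (a' + b)).
      by ring.
    by rewrite E1 E2 mulr0 subr0.
  rewrite mulf_eq0 subr_eq0 (negPf ab) subr_eq0 => /eqP aa'.
  move: E2; rewrite aa' opprD addrACA subrr add0r => /eqP.
  by rewrite subr_eq0 => /eqP->.
suff : (#|D| < e)%N by case: (#|A|) card_D => [|m] /=; nia.
(* The ratios are e-th roots of unity, distinct from one another and from 1, so |D| + 1 <= e. *)
have := @max_unity_roots L e (enum (1 |: [set u.1 / u.2 | u in D])) e_gt0.
rewrite -cardE cardsU1 card_in_imset // enum_uniq.
have -> : 1 \notin [set u.1 / u.2 | u in D].
  apply/imsetP => -[[x y] /setDP[/setXP[/= _ Ay]]]; rewrite inE /= => xy E.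
  case/eqP: xy; apply: (mulIf (invr_neq0 (A_neq0 _ Ay))).
  by rewrite mulfV ?A_neq0.
apply=> //; apply/allP => z; rewrite mem_enum in_setU1 unity_rootE.
case/orP=> [/eqP->|/imsetP[[x y] /setDP[/setXP[/= Ax Ay] _] ->]].
  by rewrite expr1n.
move: Ax Ay; rewrite !inE => /andP[/eqP xe _] /andP[/eqP ye _].
by rewrite expr_div_n xe ye divr1.
Qed.

(** With e the order of d, a solution i is determined by d^(i+1), an e-th root of unity on the line,
    and by its block of length p e. *)
Lemma count_carlitz_eq_notin (k L : finFieldType) (phi : {rmorphism k -> L})
    (p : nat) (charL : p \in [pchar L]) (d : L) (Q : nat) :
  #|k| = p -> #|L| = (p * Q)%N -> (p <= Q)%N -> d \notin codom phi ->
  (count (carlitz_eq d) (iota 1 (p * Q - 2)) < Q)%N.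
Proof.
move=> card_k card_L pQ d_out; have p_gt1 := prime_gt1 (pcharf_prime charL).
have d1 : d != 1.
  apply: contraNneq d_out => ->.
  by apply/codomP; exists 1; rewrite rmorph1.
have d0 : d != 0.
  apply: contraNneq d_out => ->.
  by apply/codomP; exists 0; rewrite rmorph0.
have dX : d ^+ (p * Q) = d by rewrite -card_L expf_card.
have pQ_gt1 : (1 < p * Q)%N by nia.
have last_root : carlitz_eq d (p * Q).-1.
  by apply: (carlitz_eq_pred charL); rewrite ?dvdn_mulr //; lia.
apply: leq_trans (count_iota_inner pQ_gt1 last_root) _.
have /prim_order_exists[|e e_prim e_dvd] : d ^+ (p * Q).-1 = 1.
- by apply: (mulfI d0); rewrite -exprS prednK ?mulr1 //; lia.
- by lia.
have e_gt0 := prim_order_gt0 e_prim.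
have e_gt1 : (1 < e)%N.
  rewrite ltn_neqAle e_gt0 andbT; apply: contraNneq d1 => e1.
  by have := prim_expr_order e_prim; rewrite -e1 expr1 => ->.
have co_e : coprime e (p * Q).
  apply: coprime_dvdl e_dvd _.
  by case: (p * Q)%N pQ_gt1 => // m _; exact: coprimenS.
(* As e > 1 is coprime to p Q, it does not divide Q. *)
have e_ndvd : (0 < Q %% e)%N.
  rewrite lt0n -/(dvdn e Q); apply/negP => eQ; move: co_e.
  by rewrite /coprime (gcdn_idPl _) ?dvdn_mull //; lia.
have := card_line_unity_roots d_out e_gt0; set A := [set x | _] => /= card_A.
have card_A_p : (#|A| <= p)%N.
  rewrite -card_k.
  apply: leq_trans (leq_imset_card (fun a => phi a * (1 - d) + 1) _).
  apply/subset_leq_card/subsetP => x; rewrite inE => /andP[_ /existsP[a /eqP->]].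
  exact: imset_f.
suff : (count (carlitz_eq d) (iota 0 (p * Q)) <= #|A| * (Q %/ e).+1)%N.
  (* Write Q = t e + r with r > 0, and m = |A|. For t = 0, m <= p <= Q. For t, m >= 1, the bound m
     (m - 1) < e yields t e + 1 - m (t + 1) >= (m - 1) (t (m - 1) - 1) >= 0. *)
  move/leq_trans; apply; have := divn_eq Q e.
  move: (Q %/ e)%N (Q %% e)%N e_ndvd => [|t] r r_gt0 QE; first by lia.
  case: (#|A|) card_A => [|m] /= card_A; first by rewrite mul0n.
  have : (m.+1 * m * t.+1 + t.+1 <= t.+1 * e)%N by nia.
  by nia.
rewrite -size_filter cardE -[(Q %/ e).+1](size_iota 0).
set s := filter (carlitz_eq d) _.
have s_in i : i \in s -> (i < p * Q)%N /\ carlitz_eq d i.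
  by rewrite mem_filter mem_iota => /andP[].
apply: (@size_le_mul _ _ _ (fun i => d ^+ i.+1) (fun i => i %/ p %/ e)%N).
- by rewrite filter_uniq ?iota_uniq.
- move=> i /s_in[_ /eqP di]; rewrite mem_enum inE exprAC (prim_expr_order e_prim).
  rewrite expr1n eqxx di; apply/existsP; exists i%:R.
  by rewrite rmorph_nat.
- move=> i /s_in[lt_i _]; rewrite mem_iota /= add0n ltnS leq_div2r //.
  by apply/ltnW; rewrite ltn_divLR; lia.
move=> i j /s_in[_ di] /s_in[_ dj] ij_e; apply: eq_mod_block.
- exact: coprime_dvdr (dvdn_mulr _ _) co_e.
- apply/eqP; rewrite -(eq_prim_root_expr e_prim); apply/eqP/(mulfI d0).
  by rewrite -!exprS.
- exact: (carlitz_eq_mod charL d1 di dj).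
Qed.

(** The scalar map of the ['F_p]-algebra that [pPrimeCharType] makes of [F], cast back to [F]. *)
Definition Fp_embedding (F : fieldType) (p : nat) (charF : p \in [pchar F]) :
    {rmorphism 'F_p -> F} :=
  (GRing.in_alg (pPrimeCharType charF) :
     {rmorphism 'F_p -> pPrimeCharType charF}).

Lemma count_carlitz_eq (F : finFieldType) (p : nat) (charF : p \in [pchar F])
    (d : F) :
  d != 0 -> d != 1 ->
  (count (carlitz_eq d) (iota 1 (#|F| - 2)) < #|F| %/ p + nu p)%N.
Proof.
move=> d0 d1; have p_prime := pcharf_prime charF.
have [n card_F] : exists n, #|F| = (p ^ n.+1)%N.
  have := card_pprimeChar charF; rewrite /pPrimeCharType.
  have := finNzRing_gt1 F; case: (logn _ _) => [|n]; last by exists n.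
  by move=> /[swap] ->.
rewrite card_F expnS mulKn ?prime_gt0 //.
have [/codomP[g dE]|d_out] := boolP (d \in codom (Fp_embedding charF)).
  rewrite dE (eq_count (carlitz_eq_rmorph _ g)).
  apply: count_carlitz_eq_Fp; rewrite ?expn_gt0 ?prime_gt0 ?dvdn_pred_predX //.
  - by apply: contraNneq d0 => g0; rewrite dE g0 rmorph0.
  - by apply: contraNneq d1 => g1; rewrite dE g1 rmorph1.
apply: leq_trans (leq_addr _ _).
apply: (count_carlitz_eq_notin charF (card_Fp p_prime) _ _ d_out).
  by rewrite card_F expnS.
(* For q = p the embedding is onto and leaves no room for d; hence p <= q / p. *)
rewrite -[X in (X <= _)%N]expn1 leq_exp2l ?prime_gt1 // lt0n.
apply: contraNneq d_out => n0.
by rewrite inj_card_onto ?card_F ?n0 ?card_Fp //; exact: fmorph_inj.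
Qed.

(** * Weight and interpolation *)

Lemma weight_count (F : finFieldType) (f : {poly F}) :
  weight f = count (fun i => f`_i != 0) (iota 0 (size f)).
Proof. by rewrite /weight -{1}[f : seq F](mkseq_nth 0) count_map. Qed.

(* Exponents are reduced modulo [x^q = x], which sends the support of [f] onto
   a superset of that of [g]. *)
Lemma count_coef_le_weight (F : finFieldType) (f g : {poly F}) :
  (size g <= #|F|)%N -> (forall x, f.[x] = g.[x]) ->
  (count (fun i => g`_i != 0)%R (iota 0 #|F|) <= weight f)%N.
Proof.
move=> size_g fg; have F_gt1 : (1 < #|F|)%N := finNzRing_gt1 F.
(* Exponent 0 is kept apart and positive ones land in 1, ..., q - 1, because x^(q-1) = 1 fails at x
   = 0. *)
pose red i := if i is k.+1 then (k %% #|F|.-1).+1 else 0%N.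
have red_lt i : (red i < #|F|)%N.
  case: i => [|k] /=; first exact: ltnW.
  by rewrite -ltn_predRL ltn_mod ltn_predRL.
have redE x i : x ^+ red i = x ^+ i :> F.
  case: i => //= k; have [->|x0] := eqVneq x 0; first by rewrite !expr0n.
  have x1 : x ^+ #|F|.-1 = 1.
    by apply: (mulfI x0); rewrite -exprS prednK ?expf_card ?mulr1 // ltnW.
  by rewrite !exprS expr_mod.
pose r := \sum_(i < size f) f`_i *: 'X^(red i) : {poly F}.
have gE : g = r.
  apply/eqP; rewrite -subr_eq0; apply: contraT => nz.
  have : (size (g - r)%R <= #|F|)%N.
    rewrite (leq_trans (size_polyD _ _)) // size_polyN geq_max size_g /=.
    apply: (leq_trans (size_sum _ _ _)); apply/bigmax_leqP => i _.
    by rewrite (leq_trans (size_scale_leq _ _)) // size_polyXn.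
  rewrite leqNgt => /negP[]; rewrite cardE.
  apply: (max_poly_roots nz _ (enum_uniq F)); apply/allP => x _.
  rewrite rootE hornerD hornerN -fg horner_coef horner_sum subr_eq0.
  by apply/eqP/eq_bigr => i _; rewrite hornerZ hornerXn redE.
rewrite weight_count -!size_filter.
rewrite -(size_map red [seq i <- iota 0 (size f) | _]); apply: uniq_leq_size.
  by rewrite filter_uniq ?iota_uniq.
move=> j; rewrite mem_filter => /andP[gj _].
have [i fi /eqP ij] : exists2 i : 'I_(size f), f`_i != 0 & red i == j.
  apply/exists_inP; apply: contraNT gj => /exists_inPn f0.
  rewrite gE coef_sum big1 // => i _; rewrite coefZ coefXn.
  have [->|/f0] := eqVneq f`_i 0; first by rewrite mul0r.
  by rewrite eq_sym => /negPf->; rewrite mulr0.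
by rewrite -ij; apply: map_f; rewrite mem_filter fi mem_iota /= ltn_ord.
Qed.

(* This is [('X - a%:P) ^+ q.-1], where [q = #|F|]. *)
Definition ncindicator (F : finFieldType) (a : F) : {poly F} :=
  \poly_(j < #|F|) a ^+ (#|F|.-1 - j).

Lemma mul_XsubC_ncindicator (F : finFieldType) (a : F) :
  ('X - a%:P) * ncindicator a = 'X^#|F| - a%:P.
Proof.
rewrite -opprB -[RHS]opprB mulNr; congr (- _).
rewrite -[in RHS](expf_card a) polyC_exp subrXX; congr (_ * _).
rewrite /ncindicator poly_def; apply: eq_bigr => i _.
by rewrite -mul_polyC rmorphXn.
Qed.

Lemma natr_card_eq0 (F : finFieldType) : #|F|%:R = 0 :> F.
Proof.
have [p _ charF] := finPcharP F; apply/eqP; rewrite -(dvdn_pcharf charF).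
have := card_pprimeChar charF; rewrite /pPrimeCharType => ->.
have := finNzRing_gt1 F; have := card_pprimeChar charF.
rewrite /pPrimeCharType; case: (logn _ _) => [->//|n _ _].
by rewrite expnS dvdn_mulr.
Qed.

(** Differentiate (X - a) N = X^q - a, where N is [ncindicator a]; the right side has derivative q
    X^(q-1) = 0. *)
Lemma ncindicator_deriv (F : finFieldType) (a : F) :
  ncindicator a = (a%:P - 'X) * (ncindicator a)^`().
Proof.
have /(congr1 (@deriv _)) := mul_XsubC_ncindicator a.
rewrite derivM !derivB derivX derivC derivXn subr0 mul1r.
rewrite -mulr_natl -polyC_natr natr_card_eq0 polyC0 mul0r subr0 => /eqP.
by rewrite addr_eq0 -mulNr opprB => /eqP.
Qed.

Lemma horner_ncindicator (F : finFieldType) (a x : F) :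
  (ncindicator a).[x] = (x != a)%:R.
Proof.
have [->|xa] := eqVneq x a.
  by rewrite ncindicator_deriv hornerM !hornerE subrr mul0r.
have xa0 : x - a != 0 by rewrite subr_eq0.
have := congr1 (horner^~ x) (mul_XsubC_ncindicator a).
rewrite /= hornerM !hornerD !hornerN hornerC hornerXn hornerX expf_card => e.
by apply: (mulfI xa0); rewrite e mulr1.
Qed.

(** Away from a, divide N = (a - X) N' by a - x. At a, differentiating once more gives 2 N'(a) = 0,
    which matches 0^-1 = 0. *)
Lemma horner_deriv_ncindicator (F : finFieldType) (a x : F) : 2%:R != 0 :> F ->
  (ncindicator a)^`().[x] = (a - x)^-1.
Proof.
move=> F2; have [->|xa] := eqVneq x a.
  have /(congr1 (horner^~ a \o @deriv _)) := ncindicator_deriv a.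
  rewrite /= derivM !derivB derivX derivC sub0r mulN1r !hornerE subrr mul0r addr0.
  move=> /eqP; rewrite -addr_eq0 -mulr2n -mulr_natl mulf_eq0 (negPf F2) => /eqP->.
  by rewrite invr0.
have ax0 : a - x != 0 by rewrite subr_eq0 eq_sym.
have := horner_ncindicator a x; rewrite xa {1}ncindicator_deriv.
rewrite hornerM hornerD hornerN hornerC hornerX => e.
by apply: (mulfI ax0); rewrite e mulfV.
Qed.

Lemma expf_card_sub2 (F : finFieldType) (x : F) :
  (2 < #|F|)%N -> x ^+ (#|F| - 2) = x^-1.
Proof.
move=> F_gt2; have [->|x0] := eqVneq x 0.
  by rewrite invr0 expr0n; case: eqP => //; lia.
apply: (mulfI x0); rewrite mulfV // -exprS; apply: (mulfI x0).
by rewrite -exprS mulr1 (_ : _.+2 = #|F|) ?expf_card //; lia.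
Qed.

(* [carlitz_poly a 2] agrees with a Moebius transformation away from its pole
   [b] and from [c], where [a0 x + a1] vanishes. *)
Lemma horner_carlitz_poly2 (F : finFieldType) (a : nat -> F) (x : F) :
  (2 < #|F|)%N -> 2%:R != 0 :> F -> a 0%N != 0 -> a 2%N != 0 ->
  let c := - (a 1%N / a 0%N) in let b := c - (a 0%N * a 2%N)^-1 in
  (carlitz_poly a 2).[x] =
  ((a 3%N + (a 2%N)^-1)%:P + (a 2%N)^-1 *:
     ((c - b) *: (ncindicator b)^`() - ncindicator c + ncindicator b)).[x].
Proof.
move=> F_gt2 F2 a0 a2 c b.
rewrite /carlitz_poly !hornerE !expf_card_sub2 //.
rewrite !horner_ncindicator horner_deriv_ncindicator //.
have -> : a 0%N * x + a 1%N = a 0%N * (x - c) by rewrite /c; field.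
have cb : c - b = (a 0%N * a 2%N)^-1 by rewrite /b; ring.
have nz : a 0%N * a 2%N != 0 by rewrite mulf_neq0.
(* At c the first inversion meets 0; the term (c - b) / (b - c) = -1 is offset by
   [ncindicator b]. *)
have [->|xc] := eqVneq x c.
  rewrite -[b - c]opprB cb subrr mulr0 invr0 add0r.
  have -> : (c != b) by rewrite -subr_eq0 cb invr_neq0.
  by rewrite /= mulr0n mulr1n; field; rewrite ?a0 ?a2 ?oppr_eq0 ?oner_eq0.
(* At the pole b the second inversion meets 0; [ncindicator c] supplies -1 in place of the Moebius
   term. *)
have [->|xb] := eqVneq x b.
  rewrite -[b - c]opprB cb subrr invr0 mulr0.
  have -> : (a 0%N * - (a 0%N * a 2%N)^-1)^-1 + a 2%N = 0.
    by field; rewrite a0 a2 oppr_eq0 oner_eq0.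
  by rewrite invr0 /= mulr0n mulr1n; ring.
have -> : b - x = - ((a 0%N * a 2%N)^-1 * (1 + a 0%N * a 2%N * (x - c))).
  by rewrite /b; field; apply/andP.
have xc0 : x - c != 0 by rewrite subr_eq0.
have xb0 : 1 + a 0%N * a 2%N * (x - c) != 0.
  apply: contra xb => /eqP e; rewrite -subr_eq0 /b; apply/eqP.
  by apply: (mulfI nz); rewrite mulr0 -e; field; apply/andP.
rewrite cb /= mulr1n; clear xb cb b; clearbody c; field.
by rewrite a0 a2 xc0 oppr_eq0 mulrA [a 2%N * _]mulrC xb0.
Qed.

(** * The vanishing coefficients *)

(** The expression is the coefficient of X^j in (c - b) N_b' - N_c + N_b, with N_a for
    [ncindicator a]. *)
Lemma count_coef_eq0 (F : finFieldType) (p : nat) (charF : p \in [pchar F])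
    (b c : F) :
  odd p -> c != b ->
  (count (fun j => (c - b) * (b ^+ (#|F|.-1 - j.+1) *+ j.+1)
                     - c ^+ (#|F|.-1 - j) + b ^+ (#|F|.-1 - j) == 0)%R
     (iota 1 (#|F| - 2)) < #|F| %/ p + nu p)%N.
Proof.
move=> p_odd cb; have p_prime := pcharf_prime charF.
have p_gt2 := odd_prime_gt2 p_odd p_prime.
have dvd_card : (p %| #|F|)%N by rewrite (dvdn_pcharf charF) natr_card_eq0.
have F_gt1 : (1 < #|F|)%N := finNzRing_gt1 F.
have [Q card_F] : exists Q, #|F| = (Q.+1 * p)%N.
  by have [[|Q] QE] := dvdnP dvd_card; [lia | exists Q].
have Fp : (#|F| %/ p = Q.+1)%N by rewrite card_F mulnK; lia.
have exp_pred j : (0 < j <= #|F| - 2)%N ->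
  (#|F|.-1 - j = (#|F|.-1 - j.+1).+1)%N by lia.
have [b0|b0] := eqVneq b 0.
  rewrite (eq_in_count (a2 := pred0)) ?count_pred0 ?Fp // => j.
  rewrite mem_iota => j_lt; rewrite (exp_pred j); last by lia.
  have c0 : c != 0 by rewrite -b0.
  rewrite /= b0 subr0 [0 ^+ _.+1]exprS mul0r addr0.
  (* The power 0^0 = 1 occurs only at j = q - 2; there j + 1 = -1 in F and the value is -2 c. *)
  apply/negbTE; have [|j_le] := posnP (#|F|.-1 - j.+1).
    move=> e; rewrite e !expr0 expr1 -mulr_natr -[X in _ - X]mulr1 -mulrBr.
    rewrite mulf_neq0 //.
    rewrite (_ : j.+1%:R = -1); last first.
      apply/eqP; rewrite -addr_eq0 natr1 (_ : j.+2 = #|F|); last by lia.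
      by rewrite natr_card_eq0.
    rewrite mul1r -opprD oppr_eq0 -mulr2n -(dvdn_pcharf charF).
    by rewrite gtnNdvd.
  by rewrite expr0n eqn0Ngt j_le mul0rn mulr0 sub0r oppr_eq0 expf_neq0.
have [c0|c0] := eqVneq c 0.
  (* For c = 0 the expression is -j b^(q-1-j), so the multiples of p are counted. *)
  rewrite (eq_in_count (a2 := dvdn p)) => [|j]; last first.
    rewrite mem_iota => j_lt; rewrite (exp_pred j); last by lia.
    rewrite c0 sub0r exprS mul0r subr0 -mulr_natr -natr1.
    rewrite (_ : _ + _ = - (b ^+ (#|F|.-1 - j.+1).+1) * j%:R); last first.
      by rewrite exprS; ring.
    by rewrite mulf_eq0 oppr_eq0 expf_eq0 (negPf b0) andbF (dvdn_pcharf charF).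
  rewrite -sum1_count big_mkcond /=.
  have := divn_count_dvd p (#|F| - 2); rewrite /index_iota subn1 /= => <-.
  rewrite Fp; apply: ltn_addr.
  by rewrite ltn_divLR ?prime_gt0 // -card_F ltn_subrL (ltnW F_gt1).
have d0 : b / c != 0 by rewrite mulf_neq0 ?invr_neq0.
have d1 : b / c != 1.
  by rewrite eq_sym; apply: contra cb => /eqP e; rewrite -[c]mul1r e divfK.
apply: leq_trans (count_carlitz_eq charF d0 d1); rewrite ltnS.
apply/eq_leq/eq_in_count => j; rewrite mem_iota => j_lt.
rewrite (exp_pred j); last by lia.
set m := (#|F|.-1 - j.+1)%N; have bE : b = b / c * c by rewrite divfK.
move: (b / c) bE d0 => u bE d0 {d1}.
have uX : u ^+ j.+1 * u ^+ m = 1.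
  rewrite -exprD (_ : j.+1 + m = #|F|.-1)%N; last by lia.
  by apply: (mulfI d0); rewrite -exprS prednK ?expf_card ?mulr1 // ltnW.
rewrite /carlitz_eq [in RHS]eq_sym -[in RHS]subr_eq0.
(* Multiply the coefficient by u^(j+1), which cancels u^m, and the equation by c^(m+1); the two then
   agree. *)
rewrite -(mulrI_eq0 _ (mulfI (expf_neq0 j.+1 d0))).
rewrite -[in RHS](mulrI_eq0 _ (mulfI (expf_neq0 m.+1 c0))); congr (_ == 0).
rewrite bE !exprMn [u ^+ m.+1]exprS [c ^+ m.+1]exprS -mulr_natr -natr1.
transitivity (c * c ^+ m *
  ((u ^+ j.+1 * u ^+ m) * ((1 - u) * (j%:R + 1) + u) - u ^+ j.+1)).
  by ring.
by rewrite uX; ring.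
Qed.

(** * The lower bound on the weight *)

(** The coefficients at 0 and q - 1 are disregarded; of the other q - 2, at most q / p + nu p - 1
    vanish. *)
Lemma card_sub_divn_sub_nu_le_weight (F : finFieldType) (p : nat)
    (charF : p \in [pchar F]) (f : {poly F}) :
  odd p -> carlitz_form f 2 -> (#|F| <= #|F| %/ p + 1 + nu p + weight f)%N.
Proof.
move=> p_odd [a [a0 a_neq0 f_eq]]; have p_prime := pcharf_prime charF.
have p_gt2 := odd_prime_gt2 p_odd p_prime.
have a2 : a 2%N != 0 by exact: a_neq0.
have F_gt2 : (2 < #|F|)%N.
  apply: leq_trans p_gt2 _; apply: dvdn_leq; first exact: ltnW (finNzRing_gt1 F).
  by rewrite (dvdn_pcharf charF) natr_card_eq0.
have F2 : 2%:R != 0 :> F by rewrite -(dvdn_pcharf charF) gtnNdvd.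
have values x : f.[x] = (carlitz_poly a 2).[x].
  have root_x : root ('X^#|F| - 'X) x.
    by rewrite rootE !hornerE expf_card subrr.
  have modE (g : {poly F}) : g.[x] = (g %% ('X^#|F| - 'X)).[x].
    rewrite [X in X.[x]](divp_eq g ('X^#|F| - 'X)) hornerD hornerM.
    by rewrite (rootP root_x) mulr0 add0r.
  by rewrite modE f_eq -modE.
pose c := - (a 1%N / a 0%N); pose b := c - (a 0%N * a 2%N)^-1.
have cb : c != b.
  by rewrite -subr_eq0 /b opprB addrCA subrr addr0 invr_neq0 ?mulf_neq0.
pose g := (a 3%N + (a 2%N)^-1)%:P + (a 2%N)^-1 *:
     ((c - b) *: (ncindicator b)^`() - ncindicator c + ncindicator b).
have size_nc (z : F) : (size (ncindicator z) <= #|F|)%N by exact: size_poly.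
have size_g : (size g <= #|F|)%N.
  apply: leq_trans (size_polyD _ _) _; rewrite geq_max; apply/andP; split.
    exact: leq_trans (size_polyC_leq1 _) (ltnW (ltnW F_gt2)).
  apply: leq_trans (size_scale_leq _ _) _.
  apply: leq_trans (size_polyD _ _) _; rewrite geq_max size_nc andbT.
  apply: leq_trans (size_polyD _ _) _; rewrite geq_max size_polyN size_nc andbT.
  apply: leq_trans (size_scale_leq _ _) _.
  apply/leq_sizeP => j le_j; rewrite coef_deriv nth_default ?mul0rn //.
  exact: leq_trans (size_nc b) (leqW le_j).
have w : (count (fun i => g`_i != 0)%R (iota 0 #|F|) <= weight f)%N.
  apply: count_coef_le_weight size_g _ => x.
  by rewrite values horner_carlitz_poly2.
pose Z i := g`_i == 0; pose s := iota 1 (#|F| - 2).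
have z : (count Z s < #|F| %/ p + nu p)%N.
  apply: leq_trans (count_coef_eq0 charF p_odd cb); rewrite ltnS.
  apply/eq_leq/eq_in_count => j; rewrite mem_iota => j_lt.
  rewrite /Z /g coefD coefC [j == _]gtn_eqF; last by lia.
  rewrite add0r coefZ mulf_eq0 invr_eq0 (negPf a2) /=.
  rewrite coefD coefB coefZ coef_deriv !coef_poly.
  have j_lt' : (j.+1 < #|F|)%N by lia.
  by rewrite j_lt' (ltnW j_lt').
have {}w : (count (predC Z) s <= weight f)%N.
  apply: leq_trans w.
  rewrite [X in iota 0 X](_ : #|F| = 1 + (#|F| - 2) + 1)%N; last by lia.
  rewrite !iotaD !count_cat add0n.
  by apply: leq_trans (leq_addr _ _); apply: leq_addl.
have : (count Z s + count (predC Z) s = #|F| - 2)%N.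
  by rewrite count_predC size_iota.
by clear -z w; lia.
Qed.

Theorem corollary3p4 (R : rcfType) (p : nat) (F : finFieldType)
    (p_prime : prime p) (p_odd : odd p) (charF : p \in [pchar F]) :
  (forall f : {poly F}, perm_poly f -> carlitz_rank f 2 ->
     (#|F|%:R - #|F|%:R / p%:R - 1 - (nu p)%:R : R) <= (weight f)%:R)
  /\ 0 <= ((nu p)%:R : R) <= Num.sqrt (3 * p%:R / 2 - 39 / 16) + 5 / 4.
Proof.
have p_gt0 : (p%:R : R) != 0 by rewrite pnatr_eq0 -lt0n prime_gt0.
split=> [f _ [f_form _]|].
  have := card_sub_divn_sub_nu_le_weight charF p_odd f_form.
  have dvd_card : (p %| #|F|)%N by rewrite (dvdn_pcharf charF) natr_card_eq0.
  have -> : #|F|%:R / p%:R = (#|F| %/ p)%:R :> R.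
    by rewrite -[in LHS](divnK dvd_card) natrM mulfK.
  rewrite -(ler_nat R) !natrD; lra.
rewrite ler0n /= -lerBlDr; set nu_p := (nu p)%:R; set x := nu_p - _.
(* Passing to |x| = sqrt(x^2) reduces the claim to the quadratic bound. *)
apply: (le_trans (ler_norm x)); rewrite -sqrtr_sqr ler_wsqrtr // /x /nu_p.
have := nu_quadratic_bound p_prime p_odd.
rewrite -(ler_nat R) !natrD !natrM; lra.
Qed.
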